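(* Let $(X,\tau,E)$ be a soft topological space over $X$ and let $(F,E)$ be a soft set over $X$. Then: (1) $\mathrm{cl}^s(F,E)=\mathrm{int}^s(F,E)\cup \mathrm{bd}^s(F,E)$; (2) $\mathrm{bd}^s(F,E)=\mathrm{cl}^s(F,E)\cap \mathrm{cl}^s((F,E)')=\mathrm{cl}^s(F,E)\setminus \mathrm{int}^s(F,E)$; (3) $(\mathrm{bd}^s(F,E))'=\mathrm{int}^s(F,E)\cup \mathrm{int}^s((F,E)')=\mathrm{int}^s(F,E)\cup \mathrm{ext}^s(F,E)$; (4) $\mathrm{int}^s(F,E)=(F,E)\setminus \mathrm{bd}^s(F,E)$.
   Context: Let $X$ be a universe and $E$ a nonempty set of parameters. A soft set $(F,E)$ over $X$ is a mapping $F:E\to P(X)$, where $P(X)$ is the power set of $X$. Inclusion $(F,E)\subseteq(G,E)$, union, intersection and difference $\setminus$ of soft sets are taken parameterwise (e.g. $(F,E)\subseteq(G,E)$ iff $F(e)\subseteq G(e)$ for all $e\in E$). $\Phi$ is the soft set with value $\emptyset$ at every parameter and $\widetilde X$ the soft set with value $X$ at every parameter. The relative complement is $(F,E)'=(F',E)$, $F'(e)=X\setminus F(e)$. A soft topology on $X$ is a collection $\tau$ of soft sets $(F,E)$ over $X$ containing $\Phi$ and $\widetilde X$, closed under arbitrary unions and under intersections of two members; $(X,\tau,E)$ is then a soft topological space over $X$. Members of $\tau$ are soft open; $(F,E)$ is soft closed if $(F,E)'\in\tau$. The soft closure $\overline{(F,E)}$ is the intersection of all soft closed sets containing $(F,E)$.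 A soft set $(F,E)$ is soft semi-open if there is a soft open set $(G,E)$ with $(G,E)\subseteq(F,E)\subseteq\overline{(G,E)}$; it is soft semi-closed if $(F,E)'$ is soft semi-open. The soft semi-interior $\mathrm{int}^s(F,E)$ is the union of all soft semi-open sets contained in $(F,E)$; the soft semi-closure $\mathrm{cl}^s(F,E)$ is the intersection of all soft semi-closed sets containing $(F,E)$; the soft semi-exterior is $\mathrm{ext}^s(F,E)=\mathrm{int}^s((F,E)')$; the soft semi-boundary is $\mathrm{bd}^s(F,E)=(\mathrm{int}^s(F,E)\cup \mathrm{ext}^s(F,E))'$. *)

(* Defs.v *)
From mathcomp Require Import all_boot boolp classical_sets.

Set Implicit Arguments.
Unset Strict Implicit.
Unset Printing Implicit Defensive.

Local Open Scope classical_set_scope.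

Definition soft_set (X E : Type) : Type := E -> set X.

Section SoftSetOperations.
Context {X E : Type}.
Implicit Types (F G : soft_set X E) (A : set (soft_set X E)).

Definition soft_subset F G : Prop := forall e, F e `<=` G e.

Definition soft_null : soft_set X E := fun=> set0.

Definition soft_absolute : soft_set X E := fun=> setT.

Definition soft_union F G : soft_set X E := fun e => F e `|` G e.

Definition soft_inter F G : soft_set X E := fun e => F e `&` G e.

Definition soft_diff F G : soft_set X E := fun e => F e `\` G e.

Definition soft_compl F : soft_set X E := fun e => ~` F e.

(* For A = set0 these are soft_null and soft_absolute respectively. *)
Definition soft_bigunion A : soft_set X E := fun e => \bigcup_(F in A) F e.

Definition soft_biginter A : soft_set X E := fun e => \bigcap_(F in A) F e.

End SoftSetOperations.

Record is_soft_topology (X E : Type) (tau : set (soft_set X E)) : Prop := {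
  soft_open_null : tau soft_null;
  soft_open_absolute : tau soft_absolute;
  soft_open_bigunion : forall A : set (soft_set X E),
    A `<=` tau -> tau (soft_bigunion A);
  soft_open_inter : forall F G : soft_set X E,
    tau F -> tau G -> tau (soft_inter F G)
}.

Section SoftSemiOperators.
Context {X E : Type}.
Variable tau : set (soft_set X E).
Implicit Types F G : soft_set X E.

Definition soft_open F : Prop := tau F.

Definition soft_closed F : Prop := soft_open (soft_compl F).

Definition soft_closure F : soft_set X E :=
  soft_biginter [set G | soft_closed G /\ soft_subset F G].

Definition soft_semi_open F : Prop :=
  exists G, [/\ soft_open G, soft_subset G F & soft_subset F (soft_closure G)].

Definition soft_semi_closed F : Prop := soft_semi_open (soft_compl F).

Definition soft_semi_interior F : soft_set X E :=
  soft_bigunion [set G | soft_semi_open G /\ soft_subset G F].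

Definition soft_semi_closure F : soft_set X E :=
  soft_biginter [set G | soft_semi_closed G /\ soft_subset F G].

Definition soft_semi_exterior F : soft_set X E :=
  soft_semi_interior (soft_compl F).

Definition soft_semi_boundary F : soft_set X E :=
  soft_compl (soft_union (soft_semi_interior F) (soft_semi_exterior F)).

End SoftSemiOperators.

(* Main.v *)
Require Import Defs.
From mathcomp Require Import all_boot boolp classical_sets.

(** Complementation exchanges the semi-open sets inside [F'] with the
    semi-closed sets containing [F], so De Morgan gives [cl^s F = (ext^s F)']:
    the semi-closure and the semi-boundary are both Boolean expressions in
    [I = int^s F] and [J = ext^s F].  Since [I] lies in [F] and [J] in [F'],
    the two are disjoint, and the four assertions are Boolean identities:
    [J' = I u (I u J)'] by disjointness, [(I u J)' = J' n I'] by De Morgan, and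
    [F \ (I u J)' = F n (I u J) = I].  *)

Local Open Scope classical_set_scope.

Lemma soft_complK (X E : Type) (F : soft_set X E) :
  soft_compl (soft_compl F) = F.
Proof. by apply: funext => e; apply: setCK. Qed.

Lemma soft_semi_interior_sub (X E : Type) (tau : set (soft_set X E))
    (F : soft_set X E) :
  soft_subset (soft_semi_interior tau F) F.
Proof. by move=> e x [G [_ GF] Gx]; apply: GF. Qed.

(** De Morgan: a point escapes some semi-closed [G] containing [F] exactly when
    it lies in [G'], a semi-open set contained in [F']. *)
Lemma soft_semi_closureE (X E : Type) (tau : set (soft_set X E))
    (F : soft_set X E) :
  soft_semi_closure tau F = soft_compl (soft_semi_exterior tau F).
Proof.
apply: funext => e; apply/seteqP; split => x /=.
  move=> clFx [G [semiG GF'] Gx].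
  apply: (clFx (soft_compl G)) => //; split.
    by rewrite /soft_semi_closed soft_complK.
  by move=> d y Fy Gy; apply: (GF' d y Gy).
move=> extFx G [semiG FG]; apply: contrapT => G'x.
apply: extFx; exists (soft_compl G) => //; split=> // d.
exact/subsetC/FG.
Qed.

Theorem theorem3p13 (X E : Type) (E_nonempty : inhabited E)
    (tau : set (soft_set X E)) (tau_topology : is_soft_topology tau)
    (F : soft_set X E) :
  (soft_semi_closure tau F =
     soft_union (soft_semi_interior tau F) (soft_semi_boundary tau F)) /\
  (soft_semi_boundary tau F =
     soft_inter (soft_semi_closure tau F)
                (soft_semi_closure tau (soft_compl F)) /\
   soft_inter (soft_semi_closure tau F)
              (soft_semi_closure tau (soft_compl F)) =
     soft_diff (soft_semi_closure tau F) (soft_semi_interior tau F)) /\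
  (soft_compl (soft_semi_boundary tau F) =
     soft_union (soft_semi_interior tau F)
                (soft_semi_interior tau (soft_compl F)) /\
   soft_union (soft_semi_interior tau F)
              (soft_semi_interior tau (soft_compl F)) =
     soft_union (soft_semi_interior tau F) (soft_semi_exterior tau F)) /\
  (soft_semi_interior tau F = soft_diff F (soft_semi_boundary tau F)).
Proof.
have intF := @soft_semi_interior_sub X E tau F.
have extF : soft_subset (soft_semi_exterior tau F) (soft_compl F).
  exact: soft_semi_interior_sub.
have disj e : soft_semi_interior tau F e `<=` ~` soft_semi_exterior tau F e.
  by move=> x /intF Fx /extF.
have extC : soft_semi_exterior tau (soft_compl F) = soft_semi_interior tau F.
  by rewrite /soft_semi_exterior soft_complK.
rewrite !soft_semi_closureE extC.
split; [|split; [split|split; [split|]]] => //.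
- apply: funext => e; rewrite /soft_semi_boundary /soft_union /soft_compl.
  by rewrite setCU setUIr setUCr setTI; apply/esym/setUidPr/disj.
- apply: funext => e; rewrite /soft_semi_boundary /soft_union /soft_inter.
  by rewrite /soft_compl setCU setIC.
- by rewrite /soft_semi_boundary soft_complK.
- apply: funext => e; rewrite /soft_semi_boundary /soft_diff /soft_compl.
  rewrite setDE setCK /soft_union setIUr.
  have -> : F e `&` soft_semi_exterior tau F e = set0.
    by apply/disjoints_subset/subsetCr/extF.
  by rewrite setU0; apply/esym/setIidPr/intF.
Qed.
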